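(* Let $A$ be an almost GCD domain. The following assertions are equivalent: (a) $A$ is globally perinormal; (b) $A$ is perinormal; (c) $A$ is integrally closed.
   Context: All rings are commutative unitary integral domains. A domain $A$ is an almost GCD domain (AGCD domain) if for each $x,y\in A$ there exists $n\geq 1$ such that $x^nA\cap y^nA$ is a principal ideal. An overring of $A$ is a ring $B$ between $A$ and the quotient field of $A$. An overring $B$ of $A$ is a going down overring if going down holds for $A\subseteq B$, that is, for each $Q\in\mathrm{Spec}(B)$ the induced map $\mathrm{Spec}(B_Q)\to\mathrm{Spec}(A_{Q\cap A})$ is surjective. $A$ is perinormal if every going down overring of $A$ is flat as an $A$-module. $A$ is globally perinormal if every going down overring of $A$ is a fraction ring of $A$, i.e. of the form $S^{-1}A$ for a multiplicative set $S\subseteq A\setminus\{0\}$. Integrally closed means integrally closed in its quotient field. *)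

(* Defs.v *)
From HB Require Import structures.
From mathcomp Require Import all_boot all_algebra.
From mathcomp Require Import boolp classical_sets functions.

Set Implicit Arguments.
Unset Strict Implicit.
Unset Printing Implicit Defensive.

Import GRing.Theory.
Local Open Scope classical_set_scope.
Local Open Scope ring_scope.

(* The subrings of the quotient field K = {fraction A}, their ideals and      *)
(* their localizations are all represented as subsets of K.  In particular    *)
(* the domain A itself, seen inside K, is [base_ring A].                      *)

Section Tensor.
Variable A : comNzRingType.

(* The tensor product of M and N over A is the quotient of seq (M * N), with  *)
(* [:: (m1, n1); ...; (mk, nk)] standing for the sum of the mi (x) ni, by the *)
(* least congruence of commutative monoids that makes (x) A-bilinear.         *)
(* Opposites exist in the quotient: - (m (x) n) is (- m) (x) n.               *)
Inductive tensor_eq (M N : lmodType A) : seq (M * N) -> seq (M * N) -> Prop :=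
| tensor_refl s : tensor_eq s s
| tensor_sym s t : tensor_eq s t -> tensor_eq t s
| tensor_trans s t u : tensor_eq s t -> tensor_eq t u -> tensor_eq s u
| tensor_cat s s' t t' :
    tensor_eq s s' -> tensor_eq t t' -> tensor_eq (s ++ t) (s' ++ t')
| tensor_catC s t : tensor_eq (s ++ t) (t ++ s)
| tensor_0l n : tensor_eq [:: (0, n)] [::]
| tensor_Dl m m' n : tensor_eq [:: (m + m', n)] [:: (m, n); (m', n)]
| tensor_Dr m n n' : tensor_eq [:: (m, n + n')] [:: (m, n); (m, n')]
| tensor_Z a m n : tensor_eq [:: (a *: m, n)] [:: (m, a *: n)].

Definition tensor_map (M M' N : lmodType A) (f : M -> M') (s : seq (M * N)) :=
  [seq (f u.1, u.2) | u <- s].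

Definition flat (N : lmodType A) : Prop :=
  forall (M M' : lmodType A) (f : {linear M -> M'}), injective f ->
  forall s t : seq (M * N),
    tensor_eq (tensor_map f s) (tensor_map f t) -> tensor_eq s t.

End Tensor.

Section Domain.
Variable A : idomainType.
Local Notation K := {fraction A}.
Local Notation "x %:F" := (@FracField.tofrac A x).

Definition base_ring : set K := range (@FracField.tofrac A).

Record overring := Overring {
  overring_set :> set K;
  overring_subring : subring_closed [in overring_set];
  overring_base : base_ring `<=` overring_set
}.

Section OverringModule.
Variable B : overring.

Definition overring_pred : {pred K} := [in overring_set B].

HB.instance Definition _ :=
  GRing.isSubringClosed.Build K overring_pred (overring_subring B).

Definition overring_module := {x : K | x \in overring_pred}.

HB.instance Definition _ := SubChoice.on overring_module.
HB.instance Definition _ :=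
  [SubChoice_isSubZmodule of overring_module by <:].

Lemma overring_scale_subproof (a : A) (x : overring_module) :
  a%:F * val x \in overring_pred.
Proof.
case: (overring_subring B) => _ _; apply; last exact: valP.
by apply/mem_set/overring_base; exists a.
Qed.

Definition overring_scale (a : A) (x : overring_module) : overring_module :=
  Sub (a%:F * val x) (overring_scale_subproof a x).

Lemma overring_scaleA a b x :
  overring_scale a (overring_scale b x) = overring_scale (a * b) x.
Proof. by apply/val_inj; rewrite !SubK rmorphM mulrA. Qed.

Lemma overring_scale1 : left_id 1 overring_scale.
Proof. by move=> x; apply/val_inj; rewrite SubK rmorph1 mul1r. Qed.

Lemma overring_scaleDr : right_distributive overring_scale +%R.
Proof. by move=> a x y; apply/val_inj; rewrite !(SubK, rmorphD) /= mulrDr. Qed.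

Lemma overring_scaleDl x : {morph overring_scale^~ x : a b / a + b}.
Proof. by move=> a b; apply/val_inj; rewrite !(SubK, rmorphD) /= mulrDl. Qed.

HB.instance Definition _ := GRing.Zmodule_isLmodule.Build A overring_module
  overring_scaleA overring_scale1 overring_scaleDr overring_scaleDl.

End OverringModule.

Definition fractions (R S : set K) : set K := [set x / s | x in R & s in S].

Definition spec (R : set K) : set (set K) :=
  [set P | [/\ P `<=` R, P 0 & ~ P 1] /\
    [/\ forall x y, P x -> P y -> P (x + y),
        forall r x, R r -> P x -> P (r * x) &
        forall x y, R x -> R y -> P (x * y) -> P x \/ P y]].

Definition localization (R P : set K) : set K := fractions R (R `\` P).

Definition going_down (R B : set K) : Prop :=
  forall Q, spec B Q ->
    let RP := localization R (Q `&` R) in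
    set_surj (spec (localization B Q)) (spec RP) (fun P => P `&` RP).

Definition perinormal : Prop :=
  forall B : overring, going_down base_ring B -> flat (overring_module B).

Definition globally_perinormal : Prop :=
  forall B : overring, going_down base_ring B ->
    exists S : set A, [/\ mulr_closed [in S], ~ S 0 &
      overring_set B = fractions base_ring [set s%:F | s in S]].

Definition integrally_closed : Prop :=
  forall u : K, integralOver (@FracField.tofrac A) u -> base_ring u.

Definition principal (x : A) : set A := [set x * a | a in setT].

Definition almost_gcd_domain : Prop :=
  forall x y : A, exists2 n, (0 < n)%N &
    exists d, principal (x ^+ n) `&` principal (y ^+ n) = principal d.

End Domain.

(* Main.v *)
From HB Require Import structures.
Require Import Defs.
From mathcomp Require Import all_boot all_algebra.
From mathcomp Require Import boolp classical_sets functions.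

Set Implicit Arguments.
Unset Strict Implicit.
Unset Printing Implicit Defensive.

Import GRing.Theory.
Local Open Scope classical_set_scope.
Local Open Scope ring_scope.

(* If x^n A `&` y^n A = d A, then (x / y)^n = x' / y' with y'A : x' = y'A.    *)
(* (a) => (b): fraction rings are flat.                                       *)
(* (b) => (c): An integral (x / y)^n = x' / y' has y' invertible in A, so the *)
(* integral closure B of A is a root extension of A.  Then Spec B -> Spec A   *)
(* is surjective, also locally, hence B is a going down overring and is flat. *)
(* Flatness gives (A : u)B = B for u in B, and the determinant trick turns    *)
(* this into A : u = A, that is, u is in A.                                   *)
(* (c) => (a): Let B be a going down overring and u in B, u^n = x' / y'.  If  *)
(* a prime Q of B contained y', some prime of A inside Q would contain y' but *)
(* not x'; going down lifts it to a prime of B inside Q, which contains y',   *)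
(* hence x' = u^n y' too, a contradiction.  So y' is invertible in B, and     *)
(* u y' is in A because its n-th power is.                                    *)

(** Up to taking a power, every element of the quotient field is a fraction x/y in lowest terms, in
    the sense that y divides c x only if y divides c ([almost_gcd_quotient]). Such a fraction is
    integral over A only if y is a unit ([integral_vcoprime]), so the integral closure B is a root
    extension: each of its elements has a power in A. A root extension induces surjections on
    spectra, also locally, hence goes down ([root_extension_going_down]); moreover any element of IB
    lying in A has a power in I ([extended_ideal_contract]). If B is flat, then 1 is in (A : u)B for
    each u in B ([flat_conductor]), so 1 is in (A : u) and B = A. In the other direction, a going
    down overring containing x/y in lowest terms contains 1/y ([going_down_inv]). When A is
    integrally closed, this makes it a ring of fractions, and rings of fractions are flat
    ([fractions_flat]). *)

Section Subrings.
Variable K : fieldType.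
Implicit Types R I J B C : set K.

(** * Subrings and ideals inside a field, the determinant trick, root extensions *)

Definition subring R := subring_closed [in R].

Definition ideal R I : Prop :=
  [/\ I `<=` R, I 0, forall x y, I x -> I y -> I (x + y) &
      forall r x, R r -> I x -> I (r * x)].

Section SubringTheory.
Variables (R : set K) (sR : subring R).

Lemma subring1 : R 1.
Proof. by case: sR => /set_mem. Qed.

Lemma subringB x y : R x -> R y -> R (x - y).
Proof.
by case: sR => _ sB _ Rx Ry; apply/set_mem/sB; exact/mem_set.
Qed.

Lemma subringM x y : R x -> R y -> R (x * y).
Proof.
by case: sR => _ _ sM Rx Ry; apply/set_mem/sM; exact/mem_set.
Qed.

Lemma subring0 : R 0.
Proof. by rewrite -(subrr 1); apply: subringB subring1 subring1. Qed.

Lemma subringN x : R x -> R (- x).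
Proof. by rewrite -sub0r; apply: subringB subring0. Qed.

Lemma subringD x y : R x -> R y -> R (x + y).
Proof. by move=> Rx /subringN; rewrite -{2}[y]opprK; exact: subringB. Qed.

Lemma subringX x n : R x -> R (x ^+ n).
Proof.
by move=> Rx; elim: n => [|n IHn]; rewrite ?expr0 ?exprS;
  [exact: subring1 | exact: subringM].
Qed.

Lemma subring_nat n : R n%:R.
Proof.
elim: n => [|n IHn]; first exact: subring0.
by rewrite mulrS; apply: subringD subring1 _.
Qed.

Variable I : set K.
Hypothesis iI : ideal R I.

Lemma ideal_sub : I `<=` R. Proof. by case: iI. Qed.
Lemma ideal0 : I 0. Proof. by case: iI. Qed.
Lemma idealD x y : I x -> I y -> I (x + y).
Proof. by case: iI => _ _ + _; apply. Qed.
Lemma idealMl r x : R r -> I x -> I (r * x).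
Proof. by case: iI => _ _ _; apply. Qed.
Lemma idealMr r x : R r -> I x -> I (x * r).
Proof. by rewrite mulrC; exact: idealMl. Qed.
Lemma idealX x n : (0 < n)%N -> I x -> I (x ^+ n).
Proof.
by case: n => // n _ Ix; rewrite exprSr; apply/idealMl/Ix/subringX/ideal_sub.
Qed.
Lemma idealN x : I x -> I (- x).
Proof. by rewrite -mulN1r; apply/idealMl/subringN/subring1. Qed.

(** A determinant is an integer polynomial in the entries, and congruence modulo I is compatible
    with sums and products of elements of R. *)
Lemma det_congr n (M N : 'M[K]_n) :
  (forall i j, R (M i j)) -> (forall i j, R (N i j)) ->
  (forall i j, I (M i j - N i j)) -> I (\det M - \det N).
Proof.
move=> RM RN IMN; pose E x y := [/\ R x, R y & I (x - y)].
suff [] : E (\det M) (\det N) by [].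
have ED x x' y y' : E x x' -> E y y' -> E (x + y) (x' + y').
  move=> [Rx Rx' Ix] [Ry Ry' Iy]; split; [exact: subringD.. |].
  by rewrite opprD addrACA; exact: idealD.
have EM x x' y y' : E x x' -> E y y' -> E (x * y) (x' * y').
  move=> [Rx Rx' Ix] [Ry Ry' Iy]; split; [exact: subringM.. |].
  have -> : x * y - x' * y' = x * (y - y') + (x - x') * y'.
    by rewrite mulrBr mulrBl addrA subrK.
  by apply: idealD; [exact: idealMl | exact: idealMr].
have E_refl x : R x -> E x x by split; rewrite ?subrr //; exact: ideal0.
apply: (big_ind2 E) => //; first by apply: E_refl; exact: subring0.
move=> s _; apply: (EM).
  by apply: E_refl; exact/subringX/subringN/subring1.
by apply: (big_ind2 E) => [||i _];
  [apply: E_refl; exact: subring1 | exact: EM | split].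
Qed.

(* Determinant trick: w is an eigenvalue of a matrix with entries in I. *)
Lemma ideal_eigen (F : finType) (V : F -> K) (M : F -> F -> K) (f0 : F) w :
  R w -> V f0 != 0 -> (forall f g, I (M f g)) ->
  (forall f, w * V f = \sum_g M f g * V g) -> I (w ^+ #|F|).
Proof.
move=> Rw Vf0 IM Vw; set n := #|F|.
(* Transposed, because [det0P] asks for a row vector in the left kernel. *)
pose N := \matrix_(i < n, j < n) (M (enum_val j) (enum_val i)).
have detN : \det (w%:M - N) = 0.
  apply/eqP/det0P; exists (\row_i V (enum_val i)).
    by apply/eqP => /rowP/(_ (enum_rank f0))/eqP; rewrite !mxE enum_rankK;
      apply/negP.
  rewrite mulmxBr mul_mx_scalar; apply/rowP => j; rewrite !mxE Vw.
  rewrite (reindex (fun i : 'I_n => enum_val i : F)) /=;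
    last by apply: onW_bij; exact: enum_val_bij.
  by apply/eqP; rewrite subr_eq0; apply/eqP/eq_bigr => i _; rewrite !mxE mulrC.
(* All entries of N lie in I, so w^n = det(w) is congruent to det(w - N) = 0 modulo I. *)
rewrite -det_scalar -[\det _]subr0 -detN; apply: det_congr => i j; rewrite !mxE.
- by case: (_ == _); rewrite ?mulr1n ?mulr0n //; exact: subring0.
- apply: subringB; last exact/ideal_sub/IM.
  by case: (_ == _); rewrite ?mulr1n ?mulr0n //; exact: subring0.
- by rewrite opprB addrC subrK; exact: IM.
Qed.

End SubringTheory.

Definition root_extension R C :=
  forall z, C z -> exists2 n, (0 < n)%N & R (z ^+ n).

(* The monomials in the z i with exponents < n span an R-module stable under
   the z i, because (z i)^n is in R. *)
Lemma ideal_root_extension R I k (a z : 'I_k -> K) w n : subring R ->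
  ideal R I -> (0 < n)%N -> (forall i, R (z i ^+ n)) -> (forall i, I (a i)) ->
  R w -> w = \sum_i a i * z i -> exists N, I (w ^+ N).
Proof.
move=> sR iI; case: n => // n _ Rz Ia Rw w_sum.
pose F := {ffun 'I_k -> 'I_n.+1}.
pose V (f : F) := \prod_i z i ^+ f i.
(* Exponents cycle modulo [n.+1]; on wrapping around, the factor [z i ^+ n.+1], which is in R, moves
   into the coefficient [c i f]. *)
pose next i (f : F) : F := [ffun j => if j == i then ordS (f j) else f j].
pose c i (f : F) := if (f i).+1 == n.+1 then z i ^+ n.+1 else 1.
have zV i f : z i * V f = c i f * V (next i f).
  rewrite /V (bigD1 i) //= [in RHS](bigD1 i) //= !mulrA ffunE eqxx -exprS /c.
  congr (_ * _); last by apply: eq_bigr => j /negPf ji; rewrite ffunE ji.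
  rewrite /=; case: eqP => [->|/eqP fi]; first by rewrite modnn mulr1.
  by rewrite mul1r modn_small // ltn_neqAle fi /=; exact: ltn_ord.
have Rc i f : R (c i f) by rewrite /c; case: eqP => // _; exact: subring1.
exists #|F|; apply: (@ideal_eigen R sR I iI F V
  (fun f g => \sum_(i | next i f == g) a i * c i f) [ffun=> ord0]) => //.
- by rewrite /V big1 ?oner_eq0 // => i _; rewrite ffunE expr0.
- move=> f g; apply: (big_ind I); [exact: ideal0 iI|exact: idealD iI|].
  by move=> i _; apply: idealMr iI _ _ _ _.
move=> f; rewrite w_sum mulr_suml.
rewrite (partition_big (next^~ f) xpredT) //=; apply: eq_bigr => g _.
rewrite mulr_suml; apply: eq_bigr => i /eqP <-.
by rewrite -!mulrA zV.
Qed.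

Lemma root_extension_exponent R C k (z : 'I_k -> K) : subring R ->
  root_extension R C -> (forall i, C (z i)) ->
  exists2 n, (0 < n)%N & forall i, R (z i ^+ n).
Proof.
move=> sR rC Cz.
have /choice[n nP] i : exists n, (0 < n)%N /\ R (z i ^+ n).
  by have [n] := rC _ (Cz i); exists n.
exists (\prod_i n i)%N => [|i]; first by apply: prodn_gt0 => i; case: (nP i).
rewrite (bigD1 i) //= exprM; apply: subringX => //; by case: (nP i).
Qed.

Definition extended_ideal I C : set K :=
  [set w | exists k (a z : 'I_k -> K),
     [/\ forall i, I (a i), forall i, C (z i) & w = \sum_i a i * z i]].

Lemma extended_ideal0 I C : extended_ideal I C 0.
Proof.
exists 0%N, (fun=> 0), (fun=> 0); split=> [[] //|[] //|].
by rewrite big_ord0.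
Qed.

Lemma extended_ideal_prod I C a z : I a -> C z -> extended_ideal I C (a * z).
Proof. by exists 1%N, (fun=> a), (fun=> z); split; rewrite ?big_ord1. Qed.

Lemma extended_idealD I C x y :
  extended_ideal I C x -> extended_ideal I C y -> extended_ideal I C (x + y).
Proof.
move=> [k [a [z [Ia Cz ->]]]] [l [b [t [Ib Ct ->]]]].
pose glue (u : 'I_k -> K) (v : 'I_l -> K) i :=
  match fintype.split i with inl j => u j | inr j => v j end.
exists (k + l)%N, (glue a b), (glue z t); split=> [i|i|].
- by rewrite /glue; case: fintype.split.
- by rewrite /glue; case: fintype.split.
- rewrite big_split_ord /glue /=; congr (_ + _); apply: eq_bigr => i _.
    by rewrite (unsplitK (inl i)).
  by rewrite (unsplitK (inr i)).
Qed.

Lemma extended_idealN I C x : subring C ->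
  extended_ideal I C x -> extended_ideal I C (- x).
Proof.
move=> sC [k [a [z [Ia Cz ->]]]]; exists k, a, (fun i => - z i);
  split=> // [i|].
  exact: subringN.
by rewrite -sumrN; apply: eq_bigr => i _; rewrite mulrN.
Qed.

(** The sum for w involves finitely many elements of C, which have a common exponent bringing them
    into R. *)
Lemma extended_ideal_contract R C I w : subring R -> ideal R I ->
  root_extension R C -> R w -> extended_ideal I C w -> exists N, I (w ^+ N).
Proof.
move=> sR iI rC Rw [k [a [z [Ia Cz w_sum]]]].
have [n n_gt0 Rz] := root_extension_exponent sR rC Cz.
exact: (ideal_root_extension sR iI n_gt0 Rz Ia Rw w_sum).
Qed.

End Subrings.

(** * Prime ideals, localization, and going down for root extensions *)

Section Spectrum.
Variable A : idomainType.
Local Notation K := {fraction A}.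
Local Notation "x %:F" := (@FracField.tofrac A x).
Implicit Types R C J P Q : set K.

Lemma spec_ideal R P : spec R P -> ideal R P.
Proof. by move=> [[PR P0 _] [PD PM _]]; split. Qed.

Lemma spec_proper R P : spec R P -> ~ P 1.
Proof. by move=> [[]]. Qed.

Lemma spec_prime R P x y : spec R P -> R x -> R y -> P (x * y) -> P x \/ P y.
Proof. by move=> [_ [_ _]]; apply. Qed.

Lemma spec_exp R P x n : subring R -> spec R P -> R x -> P (x ^+ n) -> P x.
Proof.
move=> sR pP Rx; elim: n => [/(spec_proper pP) //|n IHn].
by rewrite exprS => /(spec_prime pP Rx (subringX sR n Rx)) [].
Qed.

(** Krull's argument: an ideal maximal among those containing J and no power of x is prime. *)
Lemma prime_avoiding R J x : subring R -> ideal R J -> R x ->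
  (forall n, ~ J (x ^+ n)) -> exists P, [/\ spec R P, J `<=` P & ~ P x].
Proof.
move=> sR iJ Rx Jx.
(* The union with J puts J itself, represented by set0, below every chain. *)
pose good X := ideal R (J `|` X) /\ forall n, ~ (J `|` X) (x ^+ n).
have [F Fgood Ftot|X [[iM Mx] Xmax]] := @Zorn_bigcup _ good.
  have FI z : (J `|` \bigcup_(X in F) X) z ->
      J z \/ exists2 X, F X & (J `|` X) z.
    by move=> [Jz|[X FX Xz]]; [left|right; exists X => //; right].
  have IF X : F X -> J `|` X `<=` J `|` \bigcup_(X in F) X.
    by move=> FX z [Jz|Xz]; [left | right; exists X].
  split; last first.
    by move=> n /FI[|[X /Fgood[_ +] Xx]]; [exact: Jx | apply; exact: Xx].
  split.
  - move=> z /FI[/(ideal_sub iJ) //|[X /Fgood[iX _]]]; exact: (ideal_sub iX).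
  - by left; exact: ideal0 iJ.
  - have JF z X : J z -> (J `|` X) z by left.
    have DF X z t : F X -> (J `|` X) z -> (J `|` X) t ->
        (J `|` \bigcup_(X in F) X) (z + t).
      by move=> FX Xz Xt; apply: (IF X FX); case: (Fgood _ FX) => iX _;
        exact: (idealD iX).
    move=> z t /FI[Jz|[X FX Xz]] /FI[Jt|[Y FY Yt]].
    + by left; exact: idealD iJ _ _ _ _.
    + by apply: (DF Y) => //; exact: JF.
    + by apply: (DF X) => //; exact: JF.
    + have [XY|YX] := Ftot _ _ FX FY.
        by apply: (DF Y) => //; case: Xz => [|/XY]; [left|right].
      by apply: (DF X) => //; case: Yt => [|/YX]; [left|right].
  - move=> r z Rr /FI[Jz|[X FX Xz]]; first by left; exact: idealMl iJ _ _ _ _.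
    by apply: (IF X FX); case: (Fgood _ FX) => iX _; exact: (idealMl iX).
pose M := J `|` X.
have Mmax N : ideal R N -> M `<=` N -> ~ N `<=` M -> exists n, N (x ^+ n).
  move=> iN MN NM; apply: contrapT => Nx; apply: (Xmax N).
    split=> [z Xz|NX]; first by apply: MN; right.
    by apply: NM => z /NX; right.
  rewrite /good (_ : J `|` N = N); last first.
    by apply/seteqP; split=> [z [Jz|//]|z]; [apply: MN; left|right].
  by split=> // n Nn; apply: Nx; exists n.
have sum_ideal a : R a -> ~ M a ->
    exists n m r, [/\ M m, R r & x ^+ n = m + r * a].
  move=> Ra Ma.
  pose N := [set z | exists m r, [/\ M m, R r & z = m + r * a]].
  have [||Na|n [m [r]]] := Mmax N; last by exists n, m, r.
  - split.
    + by move=> _ [m [r [/(ideal_sub iM) Rm Rr ->]]];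
        exact/(subringD sR)/(subringM sR).
    + by exists 0, 0; split; [exact: ideal0 iM|exact: subring0|rewrite mul0r
      addr0].
    + move=> _ _ [m [r [Mm Rr ->]]] [m' [r' [Mm' Rr' ->]]].
      exists (m + m'), (r + r'); split; [exact: (idealD iM)|exact: subringD|].
      by rewrite mulrDl addrACA.
    + move=> s _ Rs [m [r [Mm Rr ->]]].
      exists (s * m), (s * r); split; [exact: (idealMl iM)|exact: subringM|].
      by rewrite mulrDr mulrA.
  - by move=> m Mm; exists m, 0; split; [|exact: subring0|rewrite mul0r addr0].
  - apply/Ma/Na; exists 0, 1; split; [exact: ideal0 iM|exact: subring1|].
    by rewrite mul1r add0r.
exists M; split; [|by left|by rewrite -[x]expr1; exact: Mx].
split; first by split; [exact: ideal_sub iM|exact: ideal0 iM|exact: (Mx 0)].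
split; [exact: idealD iM|exact: idealMl iM|move=> a b Ra Rb Mab].
apply: contrapT => /not_orP[/(sum_ideal a Ra)[n [m [r [Mm Rr xn]]]]].
move=> /(sum_ideal b Rb)[l [m' [r' [Mm' Rr' xl]]]].
(* Multiplying x^n = m + r a by x^l = m' + r' b puts x^(n+l) in M, since a b is in M. *)
apply: (Mx (n + l)%N); rewrite exprD xn mulrDl.
apply: (idealD iM); first by apply: (idealMr iM) => //; exact: subringX.
rewrite xl mulrDr; apply: (idealD iM).
  by apply: (idealMl iM) => //; exact: subringM.
by rewrite mulrACA; apply: (idealMl iM) => //; exact: subringM.
Qed.

Section Localization.
Variables (R P : set K).
Hypotheses (sR : subring R) (pP : spec R P).

Lemma spec_neq0 s : (R `\` P) s -> s != 0.
Proof. by move=> [_ Ps]; apply/eqP => s0; apply: Ps; rewrite s0;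
  exact: ideal0 (spec_ideal pP). Qed.

Lemma spec_complM s t : (R `\` P) s -> (R `\` P) t -> (R `\` P) (s * t).
Proof.
move=> [Rs Ps] [Rt Pt]; split; first exact: subringM.
by move=> /(spec_prime pP Rs Rt) [].
Qed.

Lemma sub_localization : R `<=` localization R P.
Proof.
move=> x Rx; exists x => //; exists 1; rewrite ?divr1 //.
by split; [exact: subring1 | exact: spec_proper pP].
Qed.

Lemma localization_subring : subring (localization R P).
Proof.
split.
- by apply: mem_set; apply: sub_localization; exact: subring1.
- move=> _ _ /set_mem[x Rx [s Ps <-]] /set_mem[y Ry [t Pt <-]]; apply/mem_set.
  exists (x * t - y * s); last exists (s * t).
  + by case: Ps Pt => Rs _ [Rt _]; apply: (subringB sR); exact: subringM.
  + exact: spec_complM.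
  + by rewrite -[- (y / t)]mulNr addf_div ?mulNr // spec_neq0.
- move=> _ _ /set_mem[x Rx [s Ps <-]] /set_mem[y Ry [t Pt <-]]; apply/mem_set.
  exists (x * y); first exact: subringM.
  by exists (s * t); [exact: spec_complM | rewrite mulf_div].
Qed.

End Localization.

(** The prime over p consists of the elements of C with a power in p. Only closure under addition is
    delicate: a power of x + y lies both in R and in pC, so [extended_ideal_contract] applies. *)
Lemma root_extension_spec_surj R C : subring R -> subring C -> R `<=` C ->
  root_extension R C -> set_surj (spec C) (spec R) (fun P => P `&` R).
Proof.
move=> sR sC RC rC p pp; have ip := spec_ideal pp.
pose q := [set z | C z /\ exists2 n, (0 < n)%N & p (z ^+ n)].
have pexp z n : R z -> p (z ^+ n) -> p z by exact: spec_exp.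
exists q; last first.
  apply/seteqP; split=> [z [[_ [n _ pz]] Rz]|z pz]; first exact: pexp pz.
  have Rz := ideal_sub ip pz.
  by split=> //; split; [exact: RC|exists 1%N].
split; split.
- by move=> z [].
- by split; [exact: subring0|exists 1%N => //; rewrite expr1; exact: ideal0 ip].
- by move=> [_ [n _]]; rewrite expr1n; exact: spec_proper pp.
- move=> x y [Cx [n n_gt0 px]] [Cy [m m_gt0 py]].
  have Cxy : C (x + y) by exact: subringD.
  (* The factor k brings the power into R; the factor n + m forces each binomial term to contain x^n
     or y^m, hence to lie in pC. *)
  split=> //; have [k k_gt0 Rxy] := rC _ Cxy.
  have [] := @extended_ideal_contract _ R C p ((x + y) ^+ (k * (n + m))) sR ip
    rC.
  + by rewrite exprM; exact: subringX.
  + rewrite exprDn; apply: (big_ind (extended_ideal p C)).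
    * exact: extended_ideal0.
    * exact: extended_idealD.
    move=> [i i_lt] _ /=; rewrite ltnS in i_lt.
    have [n_le|n_gt] := leqP n (k * (n + m) - i).
      rewrite -(subnKC n_le) exprD -mulrA -mulrnAr;
        apply: extended_ideal_prod => //.
      by rewrite -mulr_natl; apply: (subringM sC);
        [exact: subring_nat|apply: subringM => //; exact: subringX].
    have m_le : (m <= i)%N.
      rewrite -(leq_add2l n) (leq_trans (leq_pmull _ k_gt0)) //.
      by rewrite [(n + i)%N]addnC -leq_subLR ltnW.
    rewrite -(subnKC m_le) exprD mulrCA -mulrnAr;
      apply: extended_ideal_prod => //.
    by rewrite -mulr_natl; apply: (subringM sC);
      [exact: subring_nat|apply: subringM => //; exact: subringX].
  + move=> N /(spec_exp sR pp (_ : R ((x + y) ^+ (k * (n + m))))) pxy.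
    exists (k * (n + m))%N; first by rewrite muln_gt0 k_gt0 addn_gt0 n_gt0.
    by apply: pxy; rewrite exprM; exact: subringX.
- move=> r x Cr [Cx [n n_gt0 px]]; split; first exact: subringM.
  have [m m_gt0 Rr] := rC _ Cr; exists (m * n)%N;
    first by rewrite muln_gt0 m_gt0.
  have -> : (r * x) ^+ (m * n) = (r ^+ m) ^+ n * (x ^+ n) ^+ m.
    by rewrite exprMn -!exprM [(n * m)%N]mulnC.
  by apply: (idealMl ip); [exact: subringX | exact: (idealX sR ip)].
- move=> x y Cx Cy [_ [n n_gt0 pxy]].
  have [k k_gt0 Rx] := rC _ Cx; have [l l_gt0 Ry] := rC _ Cy.
  have [||||] := @spec_prime R p (x ^+ (k * (l * n))) (y ^+ (k * (l * n))) pp.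
  + by rewrite exprM; exact: subringX.
  + by rewrite mulnCA exprM; exact: subringX.
  + rewrite -exprMn mulnA mulnC exprM.
    by apply: (idealX sR ip); rewrite ?muln_gt0 ?k_gt0.
  + by left; split=> //; exists (k * (l * n))%N => //;
    rewrite !muln_gt0 k_gt0 l_gt0.
  + by right; split=> //; exists (k * (l * n))%N => //;
    rewrite !muln_gt0 k_gt0 l_gt0.
Qed.

Lemma spec_contract R C Q :
  subring R -> R `<=` C -> spec C Q -> spec R (Q `&` R).
Proof.
move=> sR RC qC; have iQ := spec_ideal qC; split; split.
- by move=> z [].
- by split; [exact: ideal0 iQ|exact: subring0].
- by move=> [/(spec_proper qC)].
- by move=> x y [Qx Rx] [Qy Ry]; split;
  [exact: idealD iQ _ _ _ _|exact: subringD].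
- move=> r x Rr [Qx Rx]; split; last exact: subringM.
  by apply: (idealMl iQ) => //; exact: RC.
- move=> x y Rx Ry [/(spec_prime qC (RC _ Rx) (RC _ Ry))[Qx|Qy] _].
    by left.
  by right.
Qed.

(** The property survives localization: (x/s)^(nm) = (x^n)^m / (s^m)^n, whose denominator avoids the
    prime Q because s does. *)
Lemma root_extension_going_down R C : subring R -> subring C -> R `<=` C ->
  root_extension R C -> going_down R C.
Proof.
move=> sR sC RC rC Q qC; have pR := spec_contract sR RC qC.
apply: root_extension_spec_surj.
- exact: localization_subring.
- exact: localization_subring.
- move=> _ [x Rx [s [Rs Ps] <-]]; exists x; first exact: RC.
  by exists s => //; split; [exact: RC|move=> Qs; exact: Ps].
- move=> _ [x Cx [s [Cs Qs] <-]].
  have [n n_gt0 Rx] := rC _ Cx; have [m m_gt0 Rs] := rC _ Cs.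
  exists (n * m)%N; first by rewrite muln_gt0 n_gt0.
  exists ((x ^+ n) ^+ m); first exact: subringX.
  exists ((s ^+ m) ^+ n); last by rewrite -!exprM expr_div_n [(m * n)%N]mulnC.
  split; first exact: subringX.
  by rewrite -exprM => -[/(spec_exp sC qC Cs)].
Qed.

Lemma principal_ideal R y : subring R -> R y -> ideal R [set y * r | r in R].
Proof.
move=> sR Ry; split.
- by move=> _ [r Rr <-]; exact: subringM.
- by exists 0; [exact: subring0|rewrite mulr0].
- by move=> _ _ [r Rr <-] [t Rt <-]; exists (r + t);
  [exact: subringD|rewrite mulrDr].
- by move=> s _ Rs [r Rr <-]; exists (s * r); [exact: subringM|rewrite mulrCA].
Qed.

End Spectrum.

(** * Fractions in lowest terms over an almost GCD domain, and (c) => (a) *)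

Section AlmostGCD.
Variable A : idomainType.
Local Notation K := {fraction A}.
Local Notation "x %:F" := (@FracField.tofrac A x).

Lemma tofrac_inj : injective (@FracField.tofrac A).
Proof. by move=> x y /eqP; rewrite tofrac_eq => /eqP. Qed.

Lemma fraction_quotient (u : K) : exists x y, y != 0 /\ u = x%:F / y%:F.
Proof.
elim/quotW: u => r; exists (\n_r), (\d_r); split; first exact: denom_ratioP.
have d0 : (\d_r)%:F != 0 by rewrite tofrac_eq0 denom_ratioP.
apply: (mulIf d0); rewrite divfK //; rewrite !piE.
apply/eqmodP; rewrite /= FracField.equivfE /FracField.mulf.
by rewrite !(numer_Ratio _ (oner_neq0 A)) !(denom_Ratio _ (oner_neq0 A)) !mulr1
  (numer_Ratio _ (denom_ratioP r)) (denom_Ratio _ (denom_ratioP r)) mulrC.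
Qed.

Lemma base_subring : subring (@base_ring A).
Proof.
split.
- by apply/mem_set; exists 1; rewrite ?rmorph1.
- move=> _ _ /set_mem[x _ <-] /set_mem[y _ <-]; apply/mem_set.
  by exists (x - y); rewrite ?rmorphB.
- move=> _ _ /set_mem[x _ <-] /set_mem[y _ <-]; apply/mem_set.
  by exists (x * y); rewrite ?rmorphM.
Qed.

Lemma overring_tofrac (B : overring A) a : overring_set B a%:F.
Proof. by apply: overring_base; exists a. Qed.

(* yA : x = yA; for x, y nonzero this amounts to xA `&` yA = xyA. *)
Definition vcoprime (x y : A) :=
  forall c, (exists d, c * x = y * d) -> exists d, c = y * d.

Lemma vcoprime_exp x y c k : vcoprime x y ->
  (exists d, c * x ^+ k = y * d) -> exists d, c = y * d.
Proof.
move=> xy; elim: k => [|k IHk]; first by rewrite mulr1.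
by rewrite exprSr mulrA => /xy /IHk.
Qed.

(** If d generates the intersection of x^n A and y^n A, then g = x^n y^n / d plays the role of a gcd
    of x^n and y^n; dividing both by g leaves x' and y'. *)
Lemma almost_gcd_quotient (u : K) : almost_gcd_domain A ->
  exists n x y, [/\ (0 < n)%N, y != 0, vcoprime x y & u ^+ n = x%:F / y%:F].
Proof.
move=> hA; have [x [y [y0 u_xy]]] := fraction_quotient u.
have [x0|x0] := eqVneq x 0.
  exists 1%N, 0, 1; split=> //; first exact: oner_neq0.
    by move=> c _; exists c; rewrite mul1r.
  by rewrite u_xy x0 rmorph0 !mul0r.
have [n n_gt0 [d dE]] := hA x y.
have xn0 : x ^+ n != 0 by rewrite expf_neq0.
have yn0 : y ^+ n != 0 by rewrite expf_neq0.
have [[y' _ xy'] [x' _ yx']] : (principal (x ^+ n) `&` principal (y ^+ n)) d.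
  by rewrite dE; exists 1; rewrite ?mulr1.
have [g _ dg] : principal d (x ^+ n * y ^+ n).
  rewrite -dE; split; first by exists (y ^+ n).
  by exists (x ^+ n); rewrite // mulrC.
have yg : y ^+ n = y' * g by apply: (mulfI xn0); rewrite mulrA xy' dg.
have xg : x ^+ n = x' * g.
  by apply: (mulfI yn0); rewrite mulrA yx' dg mulrC.
have [y'0 g0] : y' != 0 /\ g != 0 by apply/andP; rewrite -negb_or -mulf_eq0 -yg.
exists n, x', y'; split=> // [c [e cx']|].
  have [k _ dk] : principal d (c * x ^+ n).
    rewrite -dE; split; first by exists c; rewrite // mulrC.
    by exists e; rewrite // xg yg mulrA cx' mulrAC.
  by exists k; apply: (mulfI xn0); rewrite mulrA xy' dk mulrC.
rewrite u_xy expr_div_n -!rmorphXn xg yg !rmorphM /=.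
by rewrite -mulf_div divff ?mulr1 // tofrac_eq0.
Qed.

Lemma integralX (u : K) n : integralOver (@FracField.tofrac A) u ->
  integralOver (@FracField.tofrac A) (u ^+ n).
Proof.
move=> iu; elim: n => [|n IHn]; first exact: integral1.
by rewrite exprS; exact: integral_mul.
Qed.

(** Clearing denominators in the monic equation of degree k shows that y divides x^k; coprimality
    then makes y divide 1. *)
Lemma integral_vcoprime x y : y != 0 -> vcoprime x y ->
  integralOver (@FracField.tofrac A) (x%:F / y%:F) -> base_ring (x%:F / y%:F).
Proof.
move=> y0 xy [p p_monic /rootP p0].
have yF0 : y%:F != 0 by rewrite tofrac_eq0.
suff [d d1] : exists d, 1 = y * d.
  exists (x * d) => //; apply: (mulIf yF0).
  by rewrite divfK // -rmorphM -mulrA [d * y]mulrC -d1 mulr1.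
apply: (@vcoprime_exp x y 1 (size p).-1 xy).
(* The lower terms of the homogenized equation, with one factor y taken out; each exponent of y is
   positive since i is below the degree. *)
exists (- \sum_(i < (size p).-1) p`_i * x ^+ i * y ^+ ((size p).-1 - i).-1).
apply: tofrac_inj; rewrite mul1r mulrN.
have p_gt0 : (0 < size p)%N by rewrite size_poly_gt0 monic_neq0.
move: p0; rewrite horner_coef size_map_inj_poly ?rmorph0 //;
  last exact: tofrac_inj.
rewrite -(prednK p_gt0) big_ord_recr /= coef_map /= -lead_coefE (monicP
  p_monic).
rewrite rmorph1 mul1r => /(congr1 (fun z => z * y%:F ^+ (size p).-1)).
rewrite mul0r mulrDl expr_div_n divfK ?expf_neq0 // addrC => /addr0_eq Ex.
rewrite rmorphXn rmorphN /= -[LHS]opprK Ex rmorphM rmorph_sum mulr_suml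
  mulr_sumr; congr (- _).
apply: eq_bigr => i _; rewrite coef_map /= !rmorphM !rmorphXn /= expr_div_n.
have -> : y%:F ^+ (size p).-1 = y%:F ^+ i * (y%:F * y%:F ^+ ((size p).-1 -
  i).-1).
  by rewrite -exprS prednK ?subn_gt0 // -exprD subnKC // ltnW.
rewrite !mulrA divfK ?expf_neq0 //.
by congr (_ * _); rewrite mulrC mulrA.
Qed.

Lemma integral_root_extension : almost_gcd_domain A ->
  root_extension (@base_ring A) [set u | integralOver (@FracField.tofrac A) u].
Proof.
move=> hA u iu; have [n [x [y [n_gt0 y0 xy un]]]] := almost_gcd_quotient u hA.
by exists n => //; rewrite un; apply: integral_vcoprime => //; rewrite -un;
  exact: integralX.
Qed.

Lemma going_down_inv (B : overring A) x y : going_down (@base_ring A) B ->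
  y != 0 -> vcoprime x y -> overring_set B (x%:F / y%:F) -> overring_set B
    (y%:F)^-1.
Proof.
move=> gdB y0 xy Bxy; apply: contrapT => By.
have sB : subring B := overring_subring B; have sA := base_subring.
have yF0 : y%:F != 0 by rewrite tofrac_eq0.
(* Avoiding the powers of 1 just means being proper: a non-unit y of B lies in a prime Q. *)
have [|n [b Bb]|Q [pQ yQ _]] := prime_avoiding sB (principal_ideal sB
  (overring_tofrac B y)) (x := 1).
- exact: subring1.
- rewrite expr1n => yb; apply: By.
  by have -> : y%:F^-1 = b by apply: (mulfI yF0); rewrite divff.
have {yQ} Qy : Q y%:F by apply: yQ; exists 1; [exact: subring1|rewrite mulr1].
have pP := spec_contract sA (@overring_base _ B) pQ.
set P := Q `&` @base_ring A in pP; pose RP := localization (@base_ring A) P.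
have sRP : subring RP by exact: localization_subring.
have RPF a : RP a%:F by apply: sub_localization => //; exists a.
have [|n [_ [_ [a _ <-] [_ [[s _ <-] Ps] <-]]]|p [pp yp xp]] :=
    prime_avoiding sRP (principal_ideal sRP (RPF y)) (x := x%:F).
- exact: RPF.
- have sF0 : s%:F != 0 by apply/eqP => s0; apply: Ps; rewrite s0;
  exact: ideal0 (spec_ideal pP).
  rewrite mulrA => /(canRL (mulfVK sF0));
    rewrite -!rmorphXn -!rmorphM /= => /tofrac_inj.
  (* If x^n were in y A_P, then s x^n would be in yA for some s outside P; coprimality puts s in yA,
     hence in P. *)
  move=> Es; have [d sd] : exists d, s = y * d.
    by apply: (@vcoprime_exp x y s n xy); exists a; rewrite mulrC -Es.
  apply: Ps; split; last by exists s.
  by rewrite sd rmorphM; apply: (idealMr (spec_ideal pQ)) => //;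
    exact: overring_tofrac.
(* Going down lifts p, which contains y but not x, to a prime q of B_Q; but x = (x/y) y is then in
   q. *)
have [q pq qp] := gdB Q pQ p pp; have iq := spec_ideal pq.
apply: xp; rewrite -qp; split; last exact: RPF.
rewrite -(divfK yF0 x%:F); apply: (idealMl iq).
  exact: sub_localization Bxy.
have : p y%:F by apply: yp; exists 1; [exact: subring1|rewrite mulr1].
by rewrite -qp => -[].
Qed.

Lemma integrally_closed_globally_perinormal : almost_gcd_domain A ->
  integrally_closed A -> globally_perinormal A.
Proof.
move=> hA icA B gdB; have sB : subring B := overring_subring B.
(* S is the set of all elements of A that become invertible in B. *)
exists [set s | s != 0 /\ overring_set B (s%:F)^-1]; split.
- split; first by apply/mem_set; rewrite /= oner_neq0 rmorph1 invr1;
  split=> //; exact: subring1.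
  move=> s t /set_mem[s0 Bs] /set_mem[t0 Bt]; apply/mem_set; split;
    first exact: mulf_neq0.
  by rewrite rmorphM invfM; exact: subringM.
- by move=> []; rewrite eqxx.
apply/seteqP; split=> [u Bu|_ [_ [a _ <-] [_ [s [_ Bs] <-] <-]]]; last first.
  by apply: (subringM sB) => //; exact: overring_tofrac.
have [n [x [y [n_gt0 y0 xy un]]]] := almost_gcd_quotient u hA.
have yF0 : y%:F != 0 by rewrite tofrac_eq0.
have By : overring_set B (y%:F)^-1.
  by apply: going_down_inv gdB y0 xy _; rewrite -un; exact: subringX.
exists (u * y%:F); last first.
  by exists y%:F; [exists y|rewrite mulfK].
(* Indeed (u y)^n = (x/y) y^n = x y^(n-1). *)
apply: icA; exists ('X^n - (x * y ^+ n.-1)%:P); first exact: monicXnsubC.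
apply/rootP; rewrite rmorphB /= map_polyXn map_polyC /= hornerD hornerN
  hornerXn hornerC.
rewrite exprMn un -{1}(prednK n_gt0) exprS mulrA divfK //.
by rewrite rmorphM rmorphXn subrr.
Qed.

End AlmostGCD.

(** * Rings of fractions are flat *)

Section FlatFractions.
Variables (A : idomainType) (B : overring A) (S : set A).
Local Notation K := {fraction A}.
Local Notation "x %:F" := (@FracField.tofrac A x).
Local Notation BM := (overring_module B).
Hypotheses (SM : mulr_closed [in S]) (S0 : ~ S 0).
Hypothesis BS : overring_set B = fractions (@base_ring A) [set s%:F | s in S].

Definition clears (c : A) (b : BM) := exists a, a%:F = c%:F * val b.

(* Junk value 0 when c b is not in A. *)
Definition numerator (c : A) (b : BM) : A :=
  xget 0 [set a | a%:F = c%:F * val b].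

Lemma numeratorE c b a : a%:F = c%:F * val b -> numerator c b = a.
Proof.
by move=> ab; apply: xget_unique => // a'; rewrite /= -ab => /tofrac_inj.
Qed.

Lemma numeratorP c b : clears c b -> (numerator c b)%:F = c%:F * val b.
Proof. by move=> [a ab]; rewrite (numeratorE ab). Qed.

Lemma numeratorM d c b : clears c b ->
  clears (d * c) b /\ numerator (d * c) b = d * numerator c b.
Proof.
move=> /numeratorP cb; have dcb : (d * numerator c b)%:F = (d * c)%:F * val b.
  by rewrite !rmorphM /= cb mulrA.
by split; [exists (d * numerator c b) | exact: numeratorE].
Qed.

Section Tensor.
Variable M : lmodType A.
Implicit Types s t : seq (M * BM).

Definition clears_seq c s := forall u, u \in s -> clears c u.2.

(* The image of s under the isomorphism from M (x) B to the module of
   fractions of M, after clearing the denominator c. *)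
Definition numerator_seq c s : M := \sum_(u <- s) numerator c u.2 *: u.1.

Lemma clears_cat c s t :
  clears_seq c (s ++ t) <-> clears_seq c s /\ clears_seq c t.
Proof.
split=> [st|[cs ct] u]; last by rewrite mem_cat => /orP[/cs|/ct].
by split=> u us; apply: st; rewrite mem_cat us ?orbT.
Qed.

Lemma clears_seq1 c m b : clears_seq c [:: (m, b)] <-> clears c b.
Proof.
split=> [cb|cb u]; first by apply: (cb (m, b)); rewrite inE.
by rewrite inE => /eqP ->.
Qed.

Lemma numerator_seq1 c m b : numerator_seq c [:: (m, b)] = numerator c b *: m.
Proof. by rewrite /numerator_seq big_seq1. Qed.

Lemma numerator_cat c s t :
  numerator_seq c (s ++ t) = numerator_seq c s + numerator_seq c t.
Proof. exact: big_cat. Qed.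

Lemma numerator_seqM d c s : clears_seq c s ->
  clears_seq (d * c) s /\ numerator_seq (d * c) s = d *: numerator_seq c s.
Proof.
move=> cs; split=> [u /cs /(numeratorM d)[] //|].
rewrite scaler_sumr; apply: eq_big_seq => u /cs /(numeratorM d)[_ ->].
by rewrite scalerA.
Qed.

Lemma exists_clears (b : BM) : exists2 c, S c & clears c b.
Proof.
have : overring_set B (val b) by exact: set_mem (valP b).
rewrite BS => -[_ [a _ <-] [_ [s Ss <-] ab]]; exists s => //; exists a.
rewrite -ab mulrCA divff ?mulr1 // tofrac_eq0.
by apply/eqP => s0; apply: S0; rewrite -s0.
Qed.

Lemma denominatorM c d : S c -> S d -> S (c * d).
Proof. by case: SM => _ sM Sc Sd; apply/set_mem/sM; exact/mem_set. Qed.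

Lemma exists_clears_seq s : exists2 c, S c & clears_seq c s.
Proof.
elim: s => [|[m b] s [c Sc cs]]; first by exists 1 => //; case: SM => /set_mem.
have [d Sd db] := exists_clears b; exists (d * c); first exact: denominatorM.
rewrite -cat1s; apply/clears_cat; split.
  by apply/clears_seq1; rewrite mulrC; case: (numeratorM c db).
by case: (numerator_seqM d cs).
Qed.

(** Equality of images in the module of fractions of M. The extra multiplier usual in that equality
    is absorbed by the choice of c. *)
Definition same_numerator s t := exists c, [/\ S c, clears_seq c s,
  clears_seq c t & numerator_seq c s = numerator_seq c t].

Lemma same_numerator_tensor s t : tensor_eq s t -> same_numerator s t.
Proof.
(* For the generating relations the numerators agree over any common denominator, so an arbitrary
   one will do. *)
have same1 s' t' : (forall c, clears_seq c s' -> clears_seq c t' ->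
    numerator_seq c s' = numerator_seq c t') -> same_numerator s' t'.
  move=> E; have [c Sc /clears_cat[cs ct]] := exists_clears_seq (s' ++ t').
  by exists c; split=> //; exact: E.
elim=> {s t} [s|s t _ [c [Sc cs ct E]]|s t u _ [c [Sc cs ct E]] _
    [d [Sd dt du E']]|
  s s' t t' _ [c [Sc cs cs' E]] _ [d [Sd dt dt' E']]|s t|n|m m' n|m n n'|a m n].
- exact: same1.
- by exists c; split.
- exists (d * c); have [dcs Es] := numerator_seqM d cs.
  have [cdu Eu] := numerator_seqM c du; have [_ Et] := numerator_seqM c dt.
  split; rewrite ?[d * c]mulrC //; [by rewrite [c * d]mulrC;
    exact: denominatorM|by rewrite mulrC|].
  have [_ Et'] := numerator_seqM d ct.
  by rewrite Eu -E' -Et [c * d]mulrC Es E Et'.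
- exists (d * c); have [dcs Es] := numerator_seqM d cs.
  have [dcs' Es'] := numerator_seqM d cs'.
  have [cdt Et] := numerator_seqM c dt; have [cdt' Et'] := numerator_seqM c dt'.
  rewrite mulrC in cdt Et; rewrite mulrC in cdt' Et'.
  split; [exact: denominatorM|exact/clears_cat|exact/clears_cat|].
  by rewrite !numerator_cat Es Es' Et Et' E E'.
- by apply: same1 => c _ _; rewrite !numerator_cat addrC.
- by apply: same1 => c _ _;
  rewrite numerator_seq1 scaler0 /numerator_seq big_nil.
- apply: same1 => c _ _; rewrite -[[:: (m, n); _]]cat1s numerator_cat.
  by rewrite !numerator_seq1 scalerDr.
- apply: same1 => c _ /(clears_cat c [:: _] [:: _])[/clears_seq1 cn
  /clears_seq1 cn'].
  rewrite -[[:: (m, n); _]]cat1s numerator_cat !numerator_seq1 -scalerDl.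
  congr (_ *: _); apply: numeratorE.
  by rewrite rmorphD /= !numeratorP // mulrDr.
- apply: same1 => c /clears_seq1 cn _; rewrite !numerator_seq1 scalerA.
  congr (_ *: _); apply/esym/numeratorE.
  by rewrite rmorphM /= numeratorP // mulrAC -mulrA.
Qed.

(** If c b = a is in A, then m (x) b = a m (x) 1/c, so s collapses to the single tensor of its
    numerator with 1/c. *)
Lemma tensor_same_numerator s t : same_numerator s t -> tensor_eq s t.
Proof.
move=> [c [Sc cs ct E]].
have c0 : c%:F != 0 by rewrite tofrac_eq0; apply/eqP => c0; apply: S0;
  rewrite -c0.
have Bc : c%:F^-1 \in overring_pred B.
  apply/mem_set; rewrite BS; exists 1; first by exists 1; rewrite ?rmorph1.
  by exists c%:F; [exists c|rewrite div1r].
pose ci : BM := Sub c%:F^-1 Bc.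
suff red r : clears_seq c r -> tensor_eq r [:: (numerator_seq c r, ci)].
  apply: tensor_trans (red _ cs) _; rewrite E; exact: tensor_sym (red _ ct).
elim: r => [_|[m b] r IHr].
  rewrite /numerator_seq big_nil; exact/tensor_sym/tensor_0l.
rewrite -cat1s => /clears_cat[/clears_seq1 cb /IHr{}IHr].
apply: tensor_trans (tensor_cat _ IHr) _.
  have {1}-> : b = numerator c b *: ci.
    apply: val_inj; rewrite /= numeratorP //.
    by rewrite mulrAC divff // mul1r.
  exact/tensor_sym/tensor_Z.
by rewrite numerator_cat numerator_seq1; apply/tensor_sym/tensor_Dl.
Qed.

End Tensor.

(** Taking numerators commutes with f, and numerators lie in M itself, where injectivity of f
    applies. *)
Lemma fractions_flat : flat BM.
Proof.
move=> M M' f f_inj s t /same_numerator_tensor[c [Sc cs ct E]].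
have numf r : numerator_seq c (tensor_map f r) = f (numerator_seq c r).
  rewrite /numerator_seq big_map linear_sum; apply: eq_bigr => u _.
  by rewrite linearZ.
apply: tensor_same_numerator; exists c; split=> // [u us|u ut|].
- by apply: (cs (f u.1, u.2)); apply/mapP; exists u.
- by apply: (ct (f u.1, u.2)); apply/mapP; exists u.
- by apply: f_inj; rewrite -!numf.
Qed.

End FlatFractions.

(** * The conductor of an element of a flat overring *)

Section TwoGenerated.
Variables (A : idomainType) (x y : A).

(** The ideal (x, y) as a submodule of A; flatness is tested on its inclusion into A. *)
Definition ideal2 : {pred A^o} :=
  [in [set a : A | exists r s, a = r * y + s * x]].

Lemma ideal2_closed : submod_closed ideal2.
Proof.
split; first by apply/mem_set; exists 0, 0; rewrite !mul0r addr0.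
move=> a _ _ /set_mem[r [s ->]] /set_mem[r' [s' ->]]; apply/mem_set.
exists (a * r + r'), (a * s + s').
by rewrite !mulrDl [a *: _]mulrDr !mulrA addrACA.
Qed.

HB.instance Definition _ := GRing.isSubmodClosed.Build A A^o ideal2
  ideal2_closed.

Definition ideal2_module := {a : A^o | a \in ideal2}.
HB.instance Definition _ := SubChoice.on ideal2_module.
HB.instance Definition _ := [SubChoice_isSubLmodule of ideal2_module by <:].

Lemma mem_ideal2 r s : (r * y + s * x : A) \in ideal2.
Proof. by apply/mem_set; exists r, s. Qed.

End TwoGenerated.

Section FlatOverring.
Variables (A : idomainType) (B : overring A).
Local Notation K := {fraction A}.
Local Notation "x %:F" := (@FracField.tofrac A x).

(** The denominator ideal (A : u), equal to yA : x when u = x/y; it contains 1 exactly when u is in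
    A. *)
Definition conductor (u : K) : set K :=
  [set z | base_ring z /\ base_ring (z * u)].

Lemma conductor_ideal u : ideal (@base_ring A) (conductor u).
Proof.
have sA := base_subring A; split.
- by move=> z [].
- by split; rewrite ?mul0r; exact: subring0.
- by move=> z t [Az Azu] [At Atu]; split; rewrite ?mulrDl; exact: subringD.
- by move=> r z Ar [Az Azu]; split; rewrite -?mulrA; exact: subringM.
Qed.

(* In A (x) B, y (x) u = x (x) 1 where u = x / y, so by flatness this holds in
   (x, y) (x) B.  The map r y + s x |-> s is well defined from (x, y) to
   A / conductor u, and tensoring it with B sends y (x) u to 0 and x (x) 1 to
   1, hence 1 is in (conductor u) B. *)
Lemma flat_conductor u : flat (overring_module B) -> overring_set B u ->
  extended_ideal (conductor u) B 1.
Proof.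
move=> flatB Bu; have sB : subring B := overring_subring B.
have [x [y [y0 u_xy]]] := fraction_quotient u.
have yF0 : y%:F != 0 by rewrite tofrac_eq0.
pose I := ideal2_module x y.
pose coef (m : I) : A := xget 0 [set s | exists r, val m = r * y + s * x].
have coefP m : exists r, val m = r * y + coef m * x.
  have [r [s Em]] : exists r s, val m = r * y + s * x by
    exact: set_mem (valP m).
  exact: (@xgetI _ 0 [set s | exists r, val m = r * y + s * x] s
    (ex_intro _ r Em)).
(* If r y + s x = r' y + s' x, then (s' - s) u = r - r' is in A, so the chosen coefficient is unique
   modulo the conductor. *)
have coef_uniq (m : I) r s :
  val m = r * y + s * x -> conductor u (coef m - s)%:F.
  have [r' -> /eqP] := coefP m; rewrite -subr_eq0 opprD addrACA -!mulrBl.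
  rewrite addrC addr_eq0 => /eqP Es; split; first by exists (coef m - s).
  exists (r - r') => //; apply: (mulIf yF0).
  by rewrite u_xy -mulrA divfK // -!rmorphM /= Es -mulNr opprB.
pose ev (v : I * overring_module B) : K := (coef v.1)%:F * val v.2.
pose J := extended_ideal (conductor u) B.
have JB z t : J (z - t) -> J (t - z) by rewrite -[t - z]opprB;
  exact: extended_idealN.
(* [ev] is bilinear modulo J, so it factors through the tensor product. *)
have evJ s t : tensor_eq s t -> J (\sum_(v <- s) ev v - \sum_(v <- t) ev v).
  elim=> {s t} [s|s t _|s t w _ IH1 _ IH2|s s' t t' _ IH1 _ IH2|s t|n|m m' n|m
    n n'|a m n].
  - by rewrite subrr; exact: extended_ideal0.
  - exact: JB.
  - by rewrite -(subrKA (\sum_(v <- t) ev v)); exact: extended_idealD.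
  - by rewrite !big_cat /= opprD addrACA; exact: extended_idealD.
  - by rewrite !big_cat /= [_ + \sum_(i <- s) _]addrC subrr;
    exact: extended_ideal0.
  - rewrite big_seq1 big_nil subr0; apply: extended_ideal_prod;
    last exact: set_mem (valP n).
    by rewrite -[coef _]subr0; apply: (coef_uniq _ 0); rewrite !mul0r addr0.
  - rewrite big_seq1 big_cons big_seq1 /ev /= -mulrDl -mulrBl.
    apply: extended_ideal_prod; last exact: set_mem (valP n).
    rewrite -rmorphD -rmorphB /=; have [r Em] := coefP m;
      have [r' Em'] := coefP m'.
    by apply: (coef_uniq _ (r + r')); rewrite /= Em Em' !mulrDl addrACA.
  - rewrite big_seq1 big_cons big_seq1 /ev /= mulrDr subrr;
    exact: extended_ideal0.
  - rewrite !big_seq1 /ev /= mulrA -mulrBl -rmorphM -rmorphB.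
    apply: extended_ideal_prod; last exact: set_mem (valP n).
    have [r Em] := coefP m; apply: (coef_uniq _ (a * r)).
    by rewrite /= Em [a *: _]mulrDr !mulrA [coef m * a]mulrC.
have yI : y \in ideal2 x y by have := mem_ideal2 x y 1 0;
  rewrite mul1r mul0r addr0.
have xI : x \in ideal2 x y by have := mem_ideal2 x y 0 1;
  rewrite mul1r mul0r add0r.
pose yi : I := Sub (y : A^o) yI; pose xi : I := Sub (x : A^o) xI.
have uB : u \in overring_pred B by exact: mem_set.
have oneB : 1 \in overring_pred B by apply: mem_set; exact: subring1.
pose ub : overring_module B := Sub u uB;
  pose ob : overring_module B := Sub 1 oneB.
have tens : tensor_eq [:: (yi, ub)] [:: (xi, ob)].
  apply: (flatB I A^o (val : I -> A^o) val_inj).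
  have oneE z w : @tensor_eq A A^o (overring_module B)
      [:: (z, w)] [:: (1, z *: w)].
    by rewrite -{1}[z]mulr1; exact: tensor_Z.
  apply: tensor_trans (oneE _ _) _.
  have -> : (y : A) *: ub = (x : A) *: ob.
    by apply: val_inj; rewrite /= u_xy mulrCA divff // !mulr1.
  exact/tensor_sym/oneE.
have := evJ _ _ tens; rewrite !big_seq1 /ev /= mulr1 => /JB evu.
have cy : conductor u (coef yi)%:F.
  by rewrite -[coef _]subr0; apply: (coef_uniq _ 1);
    rewrite /= mul1r mul0r addr0.
have cx : conductor u (coef xi - 1)%:F.
  by apply: (coef_uniq _ 0); rewrite /= mul1r mul0r add0r.
have B1 : overring_set B 1 by exact: subring1.
rewrite -/J; have -> : 1 = (coef xi)%:F - (coef yi)%:F * u + (coef yi)%:F * u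
    - (coef xi - 1)%:F * 1.
  by rewrite subrK mulr1 rmorphB rmorph1 opprB addrC subrK.
apply: extended_idealD; last by apply: extended_idealN => //;
  exact: extended_ideal_prod.
by apply: extended_idealD => //; exact: extended_ideal_prod.
Qed.

End FlatOverring.

(** * The implications (a) => (b) and (b) => (c) *)

Section Perinormal.
Variable A : idomainType.

Lemma globally_perinormal_perinormal : globally_perinormal A -> perinormal A.
Proof.
move=> gpA B /gpA[S [SM S0 BS]]; exact: fractions_flat BS.
Qed.

Let integral_set : set {fraction A} :=
  [set u | integralOver (@FracField.tofrac A) u].

Lemma integral_subring : subring integral_set.
Proof.
split=> [|u v /set_mem iu /set_mem iv|u v /set_mem iu /set_mem iv];
  apply/mem_set.
- exact: integral1.
- exact: integral_sub.
- exact: integral_mul.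
Qed.

Lemma base_integral : @base_ring A `<=` integral_set.
Proof. by move=> _ [a _ <-]; exact: integral_id. Qed.

Lemma perinormal_integrally_closed :
  almost_gcd_domain A -> perinormal A -> integrally_closed A.
Proof.
move=> hA pA u iu; have sA := base_subring A.
pose B := Overring integral_subring base_integral.
have rB : root_extension (@base_ring A) B := integral_root_extension hA.
have gdB := root_extension_going_down sA integral_subring base_integral rB.
have u1 := @flat_conductor A B u (pA B gdB) iu.
(* Contracting 1 from (A : u)B puts a power of 1 in (A : u). *)
have [|N] := extended_ideal_contract sA (conductor_ideal u) rB _ u1.
  exact: subring1.
by rewrite expr1n => -[_]; rewrite mul1r.
Qed.

End Perinormal.

Theorem corollary14 (A : idomainType) (hA : almost_gcd_domain A) :
  [<-> globally_perinormal A; perinormal A; integrally_closed A].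
Proof.
tfae.
- exact: globally_perinormal_perinormal.
- exact: perinormal_integrally_closed.
- exact: integrally_closed_globally_perinormal.
Qed.
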